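(* Let $G$ be an infinite group with $G \neq G'$, let $\mathbf{R}$ be an associative ring, and let $A$ be an $\mathbf{R}G$-module with $C_G(A)=1$. Suppose that $A/C_A(G)$ is an infinite $\mathbf{R}$-module and that $A/C_A(H)$ is a finite $\mathbf{R}$-module for every proper subgroup $H$ of $G$. Then $G$ is isomorphic to a quasi-cyclic $q$-group $C_{q^{\infty}}$ for some prime $q$.
   Context: $G'$ denotes the derived (commutator) subgroup of $G$. For a module $A$ over the group ring $\mathbf{R}G$ and a subgroup $H \le G$, $C_A(H)=\{a\in A : ah=a \text{ for all } h\in H\}$, which is an $\mathbf{R}$-submodule of $A$, and $C_G(A)=\{g\in G : ag=a \text{ for all } a\in A\}$. A finite (resp. infinite) $\mathbf{R}$-module is one whose underlying set is finite (resp. infinite). The quasi-cyclic $q$-group $C_{q^{\infty}}$ is the Prüfer $q$-group, i.e. the $q$-primary component of $\mathbb{Q}/\mathbb{Z}$. *)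

(* Defs.v *)
From HB Require Import structures.
From mathcomp Require Import all_boot all_order all_algebra.
From mathcomp Require Import finmap.
From mathcomp Require Import monalg.
From mathcomp Require Import boolp classical_sets functions cardinality.

Set Implicit Arguments.
Unset Strict Implicit.
Unset Printing Implicit Defensive.

Import GRing.Theory.

Local Open Scope ring_scope.

(* The multinomials library equips [{malg R[K]}] with a product only when K is
   a monoid without non-trivial units, so the group ring reuses its additive
   group of finitely supported functions and redefines the product. *)
Definition group_ring (R : pzRingType) (G : groupType) : Type := {malg R[G]}.

Section GroupRing.
Context (R : pzRingType) (G : groupType).
Implicit Types (u v w : {malg R[G]}) (g h : G).

Definition gr_one : {malg R[G]} := mkmalgU (1%g : G) (1 : R).

Definition gr_mul u v : {malg R[G]} :=
  \sum_(g <- msupp u) \sum_(h <- msupp v)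
    mkmalgU (g * h)%g (mcoeff g u * mcoeff h v).

Local Open Scope fset_scope.

Lemma gr_mulw (d1 d2 : {fset G}) u v :
  msupp u `<=` d1 -> msupp v `<=` d2 ->
  gr_mul u v = \sum_(g <- d1) \sum_(h <- d2)
    mkmalgU (g * h)%g (mcoeff g u * mcoeff h v).
Proof.
move=> le_d1 le_d2; rewrite /gr_mul (big_fset_incl _ le_d1) /=.
  apply/eq_bigr=> g _; apply/big_fset_incl => // h _ /mcoeff_outdom ->.
  by rewrite mulr0 monalgU0.
move=> g _ /mcoeff_outdom ug.
by rewrite big1 // => h _; rewrite ug mul0r monalgU0.
Qed.

Lemma gr_mul0l : left_zero 0 gr_mul.
Proof. by move=> u; rewrite /gr_mul msupp0 big_seq_fset0. Qed.

Lemma gr_mul0r : right_zero 0 gr_mul.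
Proof.
by move=> u; rewrite /gr_mul big1 // => g _; rewrite msupp0 big_seq_fset0.
Qed.

Lemma gr_mulUl c g v :
  gr_mul (mkmalgU g c) v =
  \sum_(h <- msupp v) mkmalgU (g * h)%g (c * mcoeff h v).
Proof.
rewrite (gr_mulw msuppU_le (fsubset_refl _)) big_seq_fset1.
by apply/eq_bigr => h _; rewrite mcoeffUU.
Qed.

Lemma gr_mulUr c h u :
  gr_mul u (mkmalgU h c) =
  \sum_(g <- msupp u) mkmalgU (g * h)%g (mcoeff g u * c).
Proof.
rewrite (gr_mulw (fsubset_refl _) msuppU_le).
by apply/eq_bigr => g _; rewrite big_seq_fset1 mcoeffUU.
Qed.

Lemma gr_mulUU c1 c2 g h :
  gr_mul (mkmalgU g c1) (mkmalgU h c2) = mkmalgU (g * h)%g (c1 * c2).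
Proof. by rewrite (gr_mulw msuppU_le msuppU_le) !big_seq_fset1 !mcoeffUU. Qed.

Lemma gr_mulEl u v :
  gr_mul u v = \sum_(g <- msupp u) gr_mul (mkmalgU g (mcoeff g u)) v.
Proof. by apply/eq_bigr=> g _; rewrite gr_mulUl. Qed.

Lemma gr_mulEr u v :
  gr_mul u v = \sum_(h <- msupp v) gr_mul u (mkmalgU h (mcoeff h v)).
Proof.
by rewrite {1}/gr_mul exchange_big; apply/eq_bigr=> h _; rewrite gr_mulUr.
Qed.

Lemma gr_mul1l : left_id gr_one gr_mul.
Proof.
move=> u; rewrite gr_mulUl [RHS]monalgE.
by apply/eq_bigr=> g _; rewrite mul1r mul1g.
Qed.

Lemma gr_mul1r : right_id gr_one gr_mul.
Proof.
move=> u; rewrite gr_mulUr [RHS]monalgE.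
by apply/eq_bigr=> g _; rewrite mulr1 mulg1.
Qed.

Lemma gr_mulDl : left_distributive gr_mul +%R.
Proof.
move=> u v w.
rewrite (gr_mulw (msuppD_le _ _) (fsubset_refl _)).
rewrite (gr_mulw (fsubsetUl _ (msupp v)) (fsubset_refl (msupp w))).
rewrite (gr_mulw (fsubsetUr (msupp u) _) (fsubset_refl (msupp w))).
rewrite -big_split /=; apply/eq_bigr=> g _.
rewrite -big_split /=; apply/eq_bigr=> h _.
by rewrite mcoeffD mulrDl monalgUD.
Qed.

Lemma gr_mulDr : right_distributive gr_mul +%R.
Proof.
move=> w u v.
rewrite (gr_mulw (fsubset_refl _) (msuppD_le _ _)).
rewrite (gr_mulw (fsubset_refl (msupp w)) (fsubsetUl _ (msupp v))).
rewrite (gr_mulw (fsubset_refl (msupp w)) (fsubsetUr (msupp u) _)).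
rewrite -big_split /=; apply/eq_bigr=> g _.
rewrite -big_split /=; apply/eq_bigr=> h _.
by rewrite mcoeffD mulrDr monalgUD.
Qed.

Lemma gr_mulA : associative gr_mul.
Proof.
move=> u v w.
rewrite [RHS](big_morph (gr_mul^~ _) (fun _ _ => gr_mulDl _ _ _) (gr_mul0l _)).
rewrite gr_mulEl; apply/eq_bigr=> g _.
rewrite [LHS](big_morph (gr_mul _) (fun _ _ => gr_mulDr _ _ _) (gr_mul0r _)).
rewrite [RHS](big_morph (gr_mul^~ _) (fun _ _ => gr_mulDl _ _ _) (gr_mul0l _)).
apply/eq_bigr=> h _.
rewrite [LHS](big_morph (gr_mul _) (fun _ _ => gr_mulDr _ _ _) (gr_mul0r _)).
by rewrite gr_mulEr; apply/eq_bigr=> k _; rewrite !gr_mulUU mulrA mulgA.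
Qed.

HB.instance Definition _ := GRing.Zmodule.on (group_ring R G).
HB.instance Definition _ := GRing.Zmodule_isPzRing.Build (group_ring R G)
  gr_mulA gr_mul1l gr_mul1r gr_mulDl gr_mulDr.

Definition gr_scalar (r : R) : group_ring R G := mkmalgU (1%g : G) r.
Definition gr_elt (g : G) : group_ring R G := mkmalgU g (1 : R).

Lemma gr_elt1 : gr_elt 1%g = 1.
Proof. by []. Qed.

Lemma gr_eltM g h : gr_elt (g * h)%g = gr_elt g * gr_elt h.
Proof. by rewrite [RHS]gr_mulUU mulr1. Qed.

Lemma gr_scalarC r g : gr_scalar r * gr_elt g = gr_elt g * gr_scalar r.
Proof. by rewrite /GRing.mul /= !gr_mulUU mulr1 mul1r mulg1 mul1g. Qed.

End GroupRing.

(* A right module over a ring S is a left module over the converse ring S^c. *)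
Definition rmod_act (S : pzRingType) (A : lmodType S^c) (a : A) (s : S) : A :=
  (s : S^c) *: a.

Section Centralizers.
Context (R : pzRingType) (G : groupType) (A : lmodType (group_ring R G)^c).
Implicit Types (a b : A) (g h : G) (r : R) (H : set G).

Definition gact a g : A := rmod_act a (gr_elt R g).

Definition ract a r : A := rmod_act a (gr_scalar G r).

Lemma gact1 a : gact a 1%g = a.
Proof. exact: scale1r. Qed.

Lemma gactM a g h : gact a (g * h)%g = gact (gact a g) h.
Proof. by rewrite /gact /rmod_act scalerA gr_eltM. Qed.

Lemma ract_gact a r g : gact (ract a r) g = ract (gact a g) r.
Proof.
rewrite /gact /ract /rmod_act !scalerA; congr (_ *: _).
exact: gr_scalarC.
Qed.

Definition cent_mod H : {pred A} :=
  fun a => `[< forall h, H h -> gact a h = a >].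

Lemma cent_modP H a :
  reflect (forall h, H h -> gact a h = a) (a \in cent_mod H).
Proof. exact: asboolP. Qed.

Lemma cent_mod_zmod_closed H : zmod_closed (cent_mod H).
Proof.
split=> [|a b /cent_modP aH /cent_modP bH]; apply/cent_modP => h Hh.
  exact: scaler0.
by rewrite -[in RHS](aH h Hh) -[in RHS](bH h Hh); exact: scalerBr.
Qed.

HB.instance Definition _ H :=
  GRing.isZmodClosed.Build A (cent_mod H) (cent_mod_zmod_closed H).

Lemma cent_mod_ract H a r : a \in cent_mod H -> ract a r \in cent_mod H.
Proof.
by move=> /cent_modP aH; apply/cent_modP => h Hh; rewrite ract_gact aH.
Qed.

(* Only the underlying set of the R-module A / C_A(H) is needed below, so its
   R-action, which exists by [cent_mod_ract], is left out. *)
Definition quot_cent H : zmodType := Quotient.quot (cent_mod H).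

Definition cent_grp : set G := [set g | forall a, gact a g = a]%classic.

End Centralizers.

Definition subgroup (G : groupType) (H : set G) : Prop := group_closed (mem H).

Definition derived_subgroup (G : groupType) : set G :=
  smallest (@subgroup G) [set [~ x, y]%g | x in [set: G] & y in [set: G]]%classic.

Arguments derived_subgroup : clear implicits.

Definition rat_int : {pred rat} := [in Num.int].

Lemma rat_int_zmod_closed : zmod_closed rat_int.
Proof. by split=> [|x y xZ yZ]; [exact: rpred0 | exact: (rpredB xZ yZ)]. Qed.

HB.instance Definition _ :=
  GRing.isZmodClosed.Build rat rat_int rat_int_zmod_closed.

Definition QmodZ : zmodType := Quotient.quot rat_int.

Section Quasicyclic.
Context (q : nat).

Definition primary_component : {pred QmodZ} :=
  fun x => `[< exists n : nat, x *+ (q ^ n)%N = 0 >].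

Lemma primary_component_zmod_closed : zmod_closed primary_component.
Proof.
split=> [|x y /asboolP[m xm] /asboolP[n yn]]; apply/asboolP.
  by exists 0%N.
exists (m + n)%N; rewrite expnD mulrnBl mulrnA xm mul0rn.
by rewrite mulnC mulrnA yn mul0rn subr0.
Qed.

HB.instance Definition _ := GRing.isZmodClosed.Build QmodZ primary_component
  primary_component_zmod_closed.

Definition quasicyclic : Type := {x : QmodZ | primary_component x}.

HB.instance Definition _ := SubChoice.on quasicyclic.
HB.instance Definition _ := [SubChoice_isSubZmodule of quasicyclic by <:].

End Quasicyclic.

(* Main.v *)
Require Import Defs.
From mathcomp Require Import all_boot all_order all_algebra.
From mathcomp Require Import finmap.
From mathcomp Require Import boolp classical_sets functions cardinality.

Set Implicit Arguments.
Unset Strict Implicit.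
Unset Printing Implicit Defensive.

Import GRing.Theory Num.Theory.

(** Only the action of [G] on the abelian group [A] matters.  Call a subset [S]
    of [G] small if [A / C_A(S)] is finite.  Since [C_A(S `|` T)] is the
    intersection of [C_A(S)] and [C_A(T)], the union of two small sets is small;
    and a small set cannot generate [G], because [G] is not small.  So [G] is not
    generated by two proper subgroups.  It is not cyclic either, since an
    infinite cyclic group is generated by the squares and the cubes.  Hence every
    finite subset lies in a finite union of proper cyclic subgroups and is small,
    and [G] has no proper subgroup of finite index: such a subgroup and finitely
    many coset representatives would generate [G].

    Hence [G] acts trivially on every finite quotient of [A].  Take [S] to be
    [G'] together with one element [x]: it is small, and [C_A(S)] is a
    submodule because [S] contains [G'], so [G] acts trivially on [A / C_A(S)].
    As [x] is arbitrary, [a(g - 1)(x - 1) = 0] for all [a], [g] and [x]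
    ([gact_commutator_trivial]).  Then [a(gx) = ag + ax - a] is symmetric in [g]
    and [x], and faithfulness makes [G] abelian ([mulg_commute]).  Moreover
    [x |-> a(x - 1)] is additive, and [a |-> a(x - 1)] factors through the finite
    group [A / C_A(x)], so every [x] has finite order ([torsion]).

    What remains is about abelian groups: a torsion abelian group that is neither
    cyclic nor a product of two proper subgroups is quasi-cyclic.  The primary
    decomposition leaves a single prime [q].  Zorn's lemma yields subgroups that
    are maximal among those avoiding a given element [z]; modulo such a subgroup
    [M], every element whose [q]-th power lies in [M] is a power of [z]
    ([maximal_avoiding_root]).  Taking [M] to contain all [q]-th powers shows
    that [G] is divisible by [q] ([divisible]).  So an element [z] of order [q]
    is the start of a tower of successive [q]-th roots, and with [M] now
    avoiding this [z], [G] is the product of [M] and the union of the tower; so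
    [G] is that union ([root_tower_full]), and sending the [k]-th power of the
    [n]-th member of the tower to [k / q ^ n] identifies it with the
    [q]-component of [Q / Z] ([root_tower_quasicyclic]). *)

(** * Subgroups *)

Section Subgroups.
Context (G : groupType).
Implicit Types (H K S : set G) (x y g h : G).
Local Open Scope classical_set_scope.
Local Open Scope group_scope.

Lemma subgroupP H :
  subgroup H <-> H 1 /\ (forall x y, H x -> H y -> H (x / y)).
Proof.
split=> [[H1 HF]|[H1 HF]].
  by split=> [|x y Hx Hy]; [exact: set_mem|apply: set_mem; apply: HF; exact: mem_set].
split=> [|x y]; first exact: mem_set.
by move=> /set_mem Hx /set_mem Hy; apply: mem_set; exact: HF.
Qed.

Section Closure.
Context (H : set G) (sgH : subgroup H).

Lemma subgroup1 : H 1. Proof. by case/subgroupP: sgH. Qed.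

Lemma subgroupF x y : H x -> H y -> H (x / y).
Proof. by case/subgroupP: sgH => _; exact. Qed.

Lemma subgroupV x : H x -> H x^-1.
Proof. by rewrite -[x^-1]mul1g; apply: subgroupF; exact: subgroup1. Qed.

Lemma subgroupM x y : H x -> H y -> H (x * y).
Proof. by move=> Hx /subgroupV; rewrite -{2}[y]invgK; exact: subgroupF. Qed.

Lemma subgroupX x n : H x -> H (x ^+ n).
Proof.
move=> Hx; elim: n => [|n IHn]; first by rewrite expg0; exact: subgroup1.
by rewrite expgS; exact: subgroupM.
Qed.

End Closure.

Definition cyclic_subgroup x : set G :=
  [set y | exists m n : nat, y = x ^+ m * x ^- n].

Lemma cyclic_subgroup_subgroup x : subgroup (cyclic_subgroup x).
Proof.
apply/subgroupP; split=> [|_ _ [m [n ->]] [k [l ->]]].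
  by exists 0%N, 0%N; rewrite mulgV.
exists (m + l)%N, (k + n)%N.
rewrite !expgnDr !invgM invgK !mulgA; congr (_ * _).
rewrite -!mulgA; congr (_ * _).
by apply: commute_sym; apply: commuteV; exact: commuteX2.
Qed.

Lemma cyclic_subgroup_id x : cyclic_subgroup x x.
Proof. by exists 1%N, 0%N; rewrite invg1 mulg1. Qed.

Lemma cyclic_subgroup_sub x H : subgroup H -> H x -> cyclic_subgroup x `<=` H.
Proof.
move=> sgH Hx _ [m [n ->]].
by apply: subgroupF => //; apply: subgroupX.
Qed.

Lemma cyclic_subgroup_torsion x y e : (0 < e)%N -> x ^+ e = 1 ->
  cyclic_subgroup x y -> exists k, y = x ^+ k.
Proof.
case: e => // e _ xe [m [n ->]]; exists (m + n * e)%N.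
rewrite expgnDr; congr (_ * _); apply: mulg1_eq.
by rewrite -expgnDr -mulnS mulnC expgnA xe expg1n.
Qed.

(** If [x] is itself a power of [x ^+ n] with [1 < n], two different powers of
    [x] coincide, so [x] has finite order. *)
Lemma cyclic_subgroup_exp_proper x n : infinite_set [set: G] -> (1 < n)%N ->
  cyclic_subgroup x = [set: G] -> cyclic_subgroup (x ^+ n) <> [set: G].
Proof.
move=> infG n1 xG xnG.
have [a [b xE]] : cyclic_subgroup (x ^+ n) x by rewrite xnG.
have : exists2 e, (0 < e)%N & x ^+ e = 1.
  have xab : x ^+ (n * b).+1 = x ^+ (n * a).
    by rewrite expgS expgnA {1}xE mulgVK -expgnA.
  have [ba|ab] := leqP (n * a) (n * b).
    exists ((n * b).+1 - n * a)%N; first by rewrite subn_gt0 ltnS.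
    by rewrite expgnFr ?xab ?mulgV // leqW.
  exists (n * a - (n * b).+1)%N; last by rewrite expgnFr // xab mulgV.
  rewrite subn_gt0 ltn_neqAle ab andbT; apply/eqP => nE.
  have : (n %| (n * b).+1)%N by rewrite nE dvdn_mulr.
  rewrite -addn1 dvdn_addr ?dvdn_mulr // dvdn1 => /eqP nE1.
  by rewrite nE1 in n1.
case=> e e_gt0 xe; apply: infG.
apply: (@sub_finite_set _ _ [set` [seq x ^+ i | i <- iota 0 e]]).
  move=> y _; have : cyclic_subgroup x y by rewrite xG.
  case/(cyclic_subgroup_torsion e_gt0 xe) => k -> /=.
  apply/mapP; exists (k %% e)%N; first by rewrite mem_iota add0n ltn_mod.
  by rewrite {1}(divn_eq k e) expgnDr mulnC expgnA xe expg1n mul1g.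
exact: finite_seq.
Qed.

Lemma expg_coprime_eq1 x m n : (0 < m)%N -> coprime m n ->
  x ^+ m = 1 -> x ^+ n = 1 -> x = 1.
Proof.
move=> m_gt0 /eqP mn xm xn; have [u v uE _] := egcdnP n m_gt0.
have := expg1n G u; rewrite -{1}xm -expgnA mulnC uE mn expgnDr mulnC expgnA.
by rewrite xn expg1n mul1g.
Qed.

End Subgroups.

Section Derived.
Context (G : groupType).
Local Open Scope classical_set_scope.
Local Open Scope group_scope.

Lemma derived_subgroup_subgroup : subgroup (derived_subgroup G).
Proof.
apply/subgroupP; split=> [H [sgH _]|x y Dx Dy H HP]; first exact: subgroup1.
by case: (HP) => sgH _; apply: subgroupF => //; [exact: Dx|exact: Dy].
Qed.

Lemma derived_subgroup_comm (x y : G) : derived_subgroup G [~ x, y].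
Proof.
by apply: sub_gen_smallest; exists x => //; exists y.
Qed.

End Derived.

(** * Centralizers with finite quotient *)

Section FiniteExponent.
Local Open Scope ring_scope.

(** Adding [w] permutes the elements of a finite group, hence fixes their
    sum. *)
Lemma finite_zmod_exponent (V : zmodType) : finite_set [set: V]%classic ->
  exists2 e, (0 < e)%N & forall w : V, w *+ e = 0.
Proof.
move=> finV; set s : seq V := fset_set [set: V]%classic.
have s_all v : v \in s by rewrite in_fset_set // inE.
exists (size s) => [|w]; first by move: (s_all 0); case: (s).
have sE : perm_eq s [seq v + w | v <- s].
  rewrite uniq_perm ?fset_uniq // => [|v].
    by rewrite map_inj_uniq ?fset_uniq //; exact: addIr.
  by rewrite s_all; apply/esym/mapP; exists (v - w); rewrite ?subrK.
have : \sum_(v <- s) v = \sum_(v <- [seq v + w | v <- s]) v by exact: perm_big.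
rewrite big_map big_split /=.
rewrite big_const_seq count_predT iter_addr_0.
by rewrite -[LHS]addr0 => /addrI.
Qed.

End FiniteExponent.

Section Module.
Local Open Scope quotient_scope.
Context (R : pzRingType) (G : groupType) (A : lmodType (group_ring R G)^c).
Implicit Types (a b : A) (x g h : G) (H S T : set G).
Local Open Scope classical_set_scope.
Local Open Scope ring_scope.

Lemma gactB a b g : gact (a - b) g = gact a g - gact b g.
Proof. exact: scalerBr. Qed.

Lemma gactD a b g : gact (a + b) g = gact a g + gact b g.
Proof. exact: scalerDr. Qed.

Lemma gact0 g : gact (0 : A) g = 0.
Proof. exact: scaler0. Qed.

Lemma gactMn a g n : gact (a *+ n) g = gact a g *+ n.
Proof. by elim: n => [|n IHn]; [exact: gact0|rewrite !mulrS gactD IHn]. Qed.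

Lemma gactK a g : gact (gact a g) g^-1%g = a.
Proof. by rewrite -gactM mulgV gact1. Qed.

Lemma subgroup_pointwise_stabilizer (P : set A) :
  subgroup [set g : G | forall a, P a -> gact a g = a].
Proof.
apply/subgroupP; split=> [a _|x y Px Py a Pa]; first exact: gact1.
by rewrite gactM Px // -{1}(Py a Pa) gactK.
Qed.

Definition finite_quot S := finite_set [set: quot_cent A S].

(** The label of [a] may vary inside a coset of [C_A(S)]: labels only have to
    tell different cosets apart. *)
Lemma finite_quot_labels (X : Type) (f : A -> X) S : finite_set (range f) ->
  (forall a b, f a = f b -> a - b \in cent_mod S) -> finite_quot S.
Proof.
move=> finf sepf.
have /(finite_image (fun t => \pi_(quot_cent A S) (xget 0 [set a | f a = t]))) :=
  finf.
apply: sub_finite_set => u _ /=; exists (f (repr u)); first by exists (repr u).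
rewrite -[RHS]reprK; apply/eqP; rewrite -Quotient.idealrBE; apply: sepf.
by case: xgetP => [_ -> //|/(_ (repr u))/(_ erefl)].
Qed.

Lemma finite_quot_range S : finite_quot S -> finite_set (range \pi_(quot_cent A S)).
Proof. by apply: sub_finite_set. Qed.

Lemma pi_quot_cent S a b :
  (\pi_(quot_cent A S) a = \pi_(quot_cent A S) b) <-> (a - b \in cent_mod S).
Proof. by rewrite Quotient.idealrBE; split=> /eqP. Qed.

Lemma cent_mod_subset S T : S `<=` T -> {subset (cent_mod T : {pred A}) <= cent_mod S}.
Proof. by move=> ST a /cent_modP aT; apply/cent_modP => h /ST; exact: aT. Qed.

Lemma finite_quot_subset S T : {subset (cent_mod T : {pred A}) <= cent_mod S} ->
  finite_quot T -> finite_quot S.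
Proof.
move=> sub_cent /finite_quot_range/finite_quot_labels; apply=> a b.
by move=> /pi_quot_cent /sub_cent.
Qed.

(** [C_A(S `|` T)] is the intersection of [C_A(S)] and [C_A(T)], so the quotient
    by it embeds in the product of the other two quotients. *)
Lemma finite_quotU S T : finite_quot S -> finite_quot T -> finite_quot (S `|` T).
Proof.
move=> finS finT.
apply: (@finite_quot_labels _
  (fun a => (\pi_(quot_cent A S) a, \pi_(quot_cent A T) a))).
  apply: sub_finite_set (finite_setX finS finT) => -[u v] _; exact: conj.
move=> a b [/pi_quot_cent/cent_modP abS /pi_quot_cent/cent_modP abT].
by apply/cent_modP => h [/abS|/abT].
Qed.

(** As [a(x - 1)] is fixed by [x], the element [a(x ^+ n - 1)] is [n] times
    [a(x - 1)], that is, the image of [na] under [x - 1].  It vanishes when [n]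
    is the exponent of [A / C_A(x)]. *)
Lemma finite_quot1_torsion x : finite_quot [set x] ->
  (forall a, gact (gact a x - a) x = gact a x - a) ->
  exists2 e, (0 < e)%N & forall a, gact a (x ^+ e)%g = a.
Proof.
move=> /finite_zmod_exponent[e e_gt0 eQ] xx; exists e => // a.
set d := gact a x - a; have dx : gact d x = d by exact: xx.
have powE n : gact a (x ^+ n)%g = a + d *+ n.
  elim: n => [|n IHn]; first by rewrite expg0 gact1 addr0.
  by rewrite expgSr gactM IHn gactD gactMn dx mulrS addrA [a + d]addrC subrK.
have /cent_modP ae : a *+ e \in cent_mod [set x].
  have /eqP := eQ (\pi_(quot_cent A [set x]) a).
  by rewrite -raddfMn piE Quotient.equivE subr0.
by rewrite powE mulrnBl -gactMn ae // subrr addr0.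
Qed.

Section ProperSubgroupsFinite.
Context (infG : infinite_set [set: G]).
Context (infA : ~ finite_quot [set: G]).
Context (finA : forall H, subgroup H -> H <> [set: G] -> finite_quot H).

(** If [S] generates [G], then [C_A(S)] is [C_A(G)]. *)
Lemma finite_quot_not_generating S : finite_quot S ->
  ~ (forall H, subgroup H -> S `<=` H -> H = [set: G]).
Proof.
move=> finS genS; apply/infA/(finite_quot_subset _ finS) => a aS.
apply/cent_modP => h _.
have := genS _ (subgroup_pointwise_stabilizer (fun a => a \in cent_mod S)).
move=> /(_ _)/seteqP[|_ /(_ h I)]; last exact.
by move=> g Sg b bS; move/cent_modP: bS; exact.
Qed.

(** Otherwise [x ^+ 2] and [x ^+ 3] generate proper subgroups which together
    contain [x]. *)
Lemma cyclic_subgroup_proper x : cyclic_subgroup x <> [set: G].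
Proof.
move=> xG; pose H n := cyclic_subgroup (x ^+ n)%g.
have finH n : (1 < n)%N -> finite_quot (H n).
  move=> n1; apply: finA; first exact: cyclic_subgroup_subgroup.
  exact: cyclic_subgroup_exp_proper.
apply: (finite_quot_not_generating (finite_quotU (finH 2 isT) (finH 3 isT))).
move=> K sgK; rewrite subUset => -[K2 K3].
apply/seteqP; split=> // y _.
have : cyclic_subgroup x y by rewrite xG.
apply: cyclic_subgroup_sub => //.
have -> : x = (x ^+ 3 / x ^+ 2)%g by rewrite -expgnFr.
by apply: subgroupF => //; [apply: K3|apply: K2]; exact: cyclic_subgroup_id.
Qed.

Lemma finite_quot1 x : finite_quot [set x].
Proof.
apply: (@finite_quot_subset _ (cyclic_subgroup x)).
  by apply: cent_mod_subset => _ ->; exact: cyclic_subgroup_id.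
apply: finA; last exact: cyclic_subgroup_proper.
exact: cyclic_subgroup_subgroup.
Qed.

Lemma finite_quot_seq (s : seq G) : finite_quot [set` s].
Proof.
elim: s => [|x s IHs].
  apply: (@finite_quot_subset _ [set 1%g]); last exact: finite_quot1.
  by apply: cent_mod_subset => x.
apply: (@finite_quot_subset _ ([set x] `|` [set` s])).
  apply: cent_mod_subset => y /=; rewrite inE => /orP[/eqP ->|]; by [left|right].
by apply: finite_quotU => //; exact: finite_quot1.
Qed.

Lemma proper_subgroups_not_cover H K : subgroup H -> subgroup K ->
  (forall g, exists h k, [/\ H h, K k & g = h * k]%g) ->
  H = [set: G] \/ K = [set: G].
Proof.
move=> sgH sgK HK; have [|nH] := pselect (H = [set: G]); first by left.
have [|nK] := pselect (K = [set: G]); [by right|exfalso].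
apply: (finite_quot_not_generating (finite_quotU (finA sgH nH) (finA sgK nK))).
move=> L sgL; rewrite subUset => -[HL KL]; apply/seteqP; split=> // g _.
by have [h [k [/HL Lh /KL Lk ->]]] := HK g; exact: subgroupM.
Qed.

(** Otherwise [K] and finitely many representatives of its cosets, one for each
    value of [f], would form a small set that generates [G]. *)
Lemma finite_index_full K (X : Type) (f : G -> X) : subgroup K ->
  finite_set (range f) -> (forall g h, f g = f h -> K (g / h)%g) ->
  K = [set: G].
Proof.
move=> sgK finf sepf; have [//|nK] := pselect (K = [set: G]); exfalso.
have [s sE] : exists s : seq G, [set` s] = [set xget 1%g [set g | f g = t] | t in range f].
  have /finite_seqP[s sE] := finite_image (fun t => xget 1%g [set g | f g = t]) finf.
  by exists s; rewrite sE.
apply: (finite_quot_not_generating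
  (finite_quotU (finA sgK nK) (finite_quot_seq s))) => L sgL.
rewrite subUset sE => -[KL sL]; apply/seteqP; split=> // g _.
set h := xget 1%g [set h | f h = f g].
have fh : f h = f g by rewrite /h; case: xgetP => // /(_ g)/(_ erefl).
rewrite -[g](mulgVK h); apply: subgroupM => //.
  by apply/KL/sepf; rewrite fh.
by apply: sL; exists (f g) => //; exists g.
Qed.

Section ContainingDerived.
Context (S : set G) (DS : derived_subgroup G `<=` S) (finS : finite_quot S).

(** A conjugate of [h] differs from [h] by an element of [G'], hence of [S]. *)
Lemma cent_mod_gact a g : a \in cent_mod S -> gact a g \in cent_mod S.
Proof.
move=> /cent_modP aS; apply/cent_modP => h Sh.
have -> : gact (gact a g) h = gact (gact (gact a h) [~ h, g^-1]%g) g.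
  by rewrite -!gactM commgEl conjgE invgK -!mulgA mulVKg mulVg mulg1.
by rewrite (aS h) // aS //; apply: DS; exact: derived_subgroup_comm.
Qed.

(** The stabilizer of a point of the finite set [A / C_A(S)] has finite index,
    hence is [G]. *)
Lemma gact_trivial_mod a g : gact a g - a \in cent_mod S.
Proof.
pose K := [set g | gact a g - a \in cent_mod S].
have KF x y : gact a x - gact a y \in cent_mod S -> K (x / y)%g.
  by move=> /(cent_mod_gact y^-1%g); rewrite gactB gactK -gactM.
have KG : K = [set: G].
  apply: (@finite_index_full _ _ (fun h => \pi_(quot_cent A S) (gact a h))).
  - apply/subgroupP; split=> [|x y Kx Ky]; first by rewrite /K /= gact1 subrr rpred0.
    apply: KF.
    have -> : gact a x - gact a y = (gact a x - a) - (gact a y - a).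
      by rewrite opprB addrA subrK.
    exact: rpredB.
  - by apply: sub_finite_set (finite_quot_range finS) => _ [h _ <-]; exists (gact a h).
  - by move=> x y /pi_quot_cent; exact: KF.
by have : K g by rewrite KG.
Qed.

End ContainingDerived.

Context (not_perfect : derived_subgroup G <> [set: G]).

(** The quotient by the centralizer of [G' `|` [set x]] is finite and thus acted
    on trivially, so that [a(g - 1)] is fixed by [x]. *)
Lemma gact_commutator_trivial a g x : gact (gact a g - a) x = gact a g - a.
Proof.
have finD := finA (derived_subgroup_subgroup G) not_perfect.
have /cent_modP := gact_trivial_mod (@subsetUl _ _ [set x])
  (finite_quotU finD (finite_quot1 x)) a g.
by apply; right.
Qed.

Context (faithful : cent_grp A = [set 1%g]).

Lemma faithfulP x : (forall a, gact a x = a) -> x = 1%g.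
Proof. by move=> xA; have : cent_grp A x by []; rewrite faithful. Qed.

(** From [a(g - 1)(h - 1) = 0] follows [agh = ag + ah - a], which is symmetric in
    [g] and [h]. *)
Lemma mulg_commute g h : commute g h.
Proof.
have actM a x y : gact a (x * y)%g = gact a x + gact a y - a.
  by rewrite gactM -[gact a x in LHS](subrK a) gactD gact_commutator_trivial addrAC.
apply: divg1_eq; apply: faithfulP => a.
by rewrite gactM actM [gact a g + _]addrC -actM -gactM mulgV gact1.
Qed.

Lemma torsion x : exists2 e, (0 < e)%N & (x ^+ e = 1)%g.
Proof.
have [e e_gt0 xe] := finite_quot1_torsion (finite_quot1 x)
  (fun a => gact_commutator_trivial a x x).
by exists e => //; exact: faithfulP.
Qed.

End ProperSubgroupsFinite.

End Module.

(** * Abelian torsion groups *)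

Section MaximalAvoiding.
Context (G : groupType).
Local Open Scope classical_set_scope.
Local Open Scope group_scope.

(** Zorn's lemma, for the subgroups between [N] and the complement of [x]. *)
Lemma maximal_subgroup_avoiding (N : set G) x : subgroup N -> ~ N x ->
  exists M, [/\ subgroup M, N `<=` M, ~ M x &
    forall H, subgroup H -> M `<=` H -> ~ H x -> H `<=` M].
Proof.
move=> sgN nNx.
(* Adjoining [N] lets the empty chain have an upper bound. *)
pose P := [set X : set G | subgroup (N `|` X) /\ ~ (N `|` X) x].
have [F FP totF|X [[sgX nXx] maxX]] := @Zorn_bigcup G P.
  split; last first.
    by move=> [//|[X FX Xx]]; case: (FP X FX) => _; apply; right.
  have closeF X Y y z : F X -> F Y -> (N `|` X) y -> (N `|` Y) z ->
      exists2 Z, F Z & (N `|` Z) (y / z).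
    move=> FX FY Xy Yz; have [XY|YX] := totF X Y FX FY.
      exists Y => //; apply: (subgroupF (FP Y FY).1) => //.
      exact: (setUS XY Xy).
    exists X => //; apply: (subgroupF (FP X FX).1) => //.
    exact: (setUS YX Yz).
  apply/subgroupP; split=> [|y z]; first by left; exact: subgroup1.
  have lift Z t : F Z -> (N `|` Z) t -> (N `|` \bigcup_(X in F) X) t.
    by move=> FZ [Nt|Zt]; [left|right; exists Z].
  move=> [Ny|[X FX Xy]] [Nz|[Y FY Yz]].
  - by left; exact: subgroupF.
  - have [||Z FZ /(lift _ _ FZ)//] := closeF Y Y y z FY FY; by [left|right].
  - have [||Z FZ /(lift _ _ FZ)//] := closeF X X y z FX FX; by [left|right].
  - have [||Z FZ /(lift _ _ FZ)//] := closeF X Y y z FX FY; by right.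
exists (N `|` X); split=> // H sgH; rewrite subUset => -[NH XH] nHx y Hy.
right; apply: contrapT => nXy; apply: (maxX H).
  by split=> // HX; exact/nXy/HX.
have NHE : N `|` H = H by exact/setUidPr.
by rewrite /P /= NHE; split=> // -[].
Qed.

End MaximalAvoiding.

Section Abelian.
Context (G : groupType) (mulC : forall x y : G, (x * y = y * x)%g).
Local Open Scope classical_set_scope.
Local Open Scope group_scope.

Lemma divgACA (x y z t : G) : (x * y) / (z * t) = (x / z) * (y / t).
Proof. by rewrite invgM -mulgA [y * (_ * _)]mulgA [y / t * _]mulC !mulgA. Qed.

Lemma commutative_expgF (x y : G) n : (x / y) ^+ n = x ^+ n / y ^+ n.
Proof. by rewrite expgnFl. Qed.

(** [z] lies in the subgroup generated by [M] and [y], by maximality. As [M]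
    contains [y ^+ q] but not [z], the power of [y] occurring in [z] is prime
    to [q], and so can be inverted modulo [M]. *)
Lemma maximal_avoiding_root (M : set G) y z q : prime q -> subgroup M -> ~ M z ->
  (forall H, subgroup H -> M `<=` H -> ~ H z -> H `<=` M) -> M (y ^+ q) ->
  exists k m, M m /\ y = z ^+ k * m.
Proof.
move=> pq sgM nMz maxM Myq.
have [My|nMy] := pselect (M y); first by exists 0%N, y; rewrite mul1g.
pose H : set G := [set g | exists k m, M m /\ g = y ^+ k * m].
have sgH : subgroup H.
  apply/subgroupP; split=> [|_ _ [k [m [Mm ->]]] [l [n [Mn ->]]]].
    by exists 0%N, 1; rewrite mulg1; split=> //; exact: subgroup1.
  exists (k + q.-1 * l)%N, ((y ^+ q) ^- l * (m / n)); split.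
    by apply: (subgroupM sgM); [apply: (subgroupV sgM); exact: subgroupX|exact: subgroupF].
  rewrite divgACA [RHS]mulgA; congr (_ * _).
  rewrite expgnDr -[in RHS]mulgA; congr (_ * _).
  rewrite -expgnA -{2}(prednK (prime_gt0 pq)) mulSn expgnDr invgM.
  by rewrite mulVKg.
have [Hz|nHz] := pselect (H z); last first.
  exfalso; apply/nMy/(maxM H) => // [g Mg|].
    by exists 0%N, g; rewrite mul1g.
  by exists 1%N, 1; rewrite mulg1; split=> //; exact: subgroup1.
have {Hz} [k [m [Mm zE]]] := Hz.
have qk : coprime k q.
  rewrite coprime_sym prime_coprime //; apply/negP => /dvdnP[l kE].
  apply: nMz; rewrite zE kE mulnC expgnA.
  by apply: (subgroupM sgM) => //; exact: subgroupX.
have k_gt0 : (0 < k)%N.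
  rewrite lt0n; apply/eqP => k0.
  by move: qk pq; rewrite k0 /coprime gcd0n => /eqP ->.
have [u v uE _] := egcdnP q k_gt0.
exists u, ((m ^+ u)^-1 / (y ^+ q) ^+ v); split.
  by apply: (subgroupF sgM); [apply: (subgroupV sgM)|]; exact: subgroupX.
rewrite zE expgMn // mulgA mulgK -!expgnA [(k * u)%N]mulnC uE (eqP qk).
by rewrite [(v * q)%N]mulnC expgnDr mulC mulgA mulVg mul1g.
Qed.

(** Cauchy's theorem for the cyclic group generated by [x]. *)
Lemma exists_order_prime (x : G) e : (0 < e)%N -> x ^+ e = 1 -> x <> 1 ->
  exists q (y : G), [/\ prime q, y <> 1 & y ^+ q = 1].
Proof.
move=> e_gt0 xe /eqP x1.
have ex_ord : exists n, (0 < n)%N && (x ^+ n == 1).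
  by exists e; rewrite e_gt0 xe eqxx.
case: (ex_minnP ex_ord) => n /andP[n_gt0 /eqP xn] min_n.
have n_gt1 : (1 < n)%N.
  by rewrite ltn_neqAle n_gt0 andbT; apply: contraNneq x1 => nE; rewrite -xn -nE.
have pq := pdiv_prime n_gt1.
exists (pdiv n), (x ^+ (n %/ pdiv n)); split=> //; last first.
  by rewrite -expgnA divnK ?pdiv_dvd.
move=> /eqP xd; have := min_n (n %/ pdiv n)%N.
rewrite xd andbT divn_gt0 ?prime_gt0 // dvdn_leq ?pdiv_dvd // => /(_ isT).
by rewrite leqNgt ltn_Pdiv ?prime_gt1.
Qed.

Section ProperSubgroupsNotCovering.
Context (tor : forall x : G, exists2 e, (0 < e)%N & x ^+ e = 1).
Context (not_cover : forall H K : set G, subgroup H -> subgroup K ->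
  (forall g, exists h k, [/\ H h, K k & g = h * k]) ->
  H = [set: G] \/ K = [set: G]).
Context (not_cyclic : forall x : G, cyclic_subgroup x <> [set: G]).
Context (q : nat) (pq : prime q) (z : G) (z1 : z <> 1) (zq : z ^+ q = 1).

(** [G] is the product of its [q]-component and its [q']-component; the latter is
    proper, for it misses [z]. *)
Lemma primary (g : G) : exists n, g ^+ (q ^ n) = 1.
Proof.
pose H := [set g : G | exists n, g ^+ (q ^ n) = 1].
pose K := [set g : G | exists2 m, coprime q m & g ^+ m = 1].
have sgH : subgroup H.
  apply/subgroupP; split=> [|x y [n xn] [m ym]]; first by exists 0%N; rewrite expg1n.
  exists (n + m)%N; rewrite commutative_expgF expnD.
  by rewrite expgnA xn [(_ * q ^ m)%N]mulnC expgnA ym !expg1n mulgV.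
have sgK : subgroup K.
  apply/subgroupP; split=> [|x y [n qn xn] [m qm ym]].
    by exists 1%N; rewrite ?coprimen1 // expg1n.
  exists (n * m)%N; rewrite ?coprimeMr ?qn // commutative_expgF.
  by rewrite expgnA xn [(n * m)%N]mulnC expgnA ym !expg1n mulgV.
have [g'|HG|KG] := not_cover sgH sgK.
- have [e e_gt0 ge] := tor g'; have [m qm eE] := pfactor_coprime pq e_gt0.
  have m_gt0 : (0 < m)%N by move: e_gt0; rewrite eE muln_gt0 => /andP[].
  have [u v uE _] := egcdnP (q ^ logn q e) m_gt0.
  exists (g' ^+ (u * m)), (g' ^- (v * q ^ logn q e)); split.
  + exists (logn q e).
    by rewrite -expgnA -mulnA -eE mulnC expgnA ge expg1n.
  + apply: (subgroupV sgK); exists m => //.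
    by rewrite -expgnA -mulnA [(_ * m)%N]mulnC -eE mulnC expgnA ge expg1n.
  + move: uE; rewrite coprime_sym in qm.
    rewrite (eqP (coprimeXr _ qm)) => ->.
    by rewrite expgnDr mulC mulKg.
- by have : H g by rewrite HG.
- have [m qm zm] : K z by rewrite KG.
  by case: z1; exact: (expg_coprime_eq1 (prime_gt0 pq) qm).
Qed.

(** Otherwise a maximal subgroup among those that contain all [q]-th powers and
    avoid [g] generates [G] together with [g]. *)
Lemma divisible (g : G) : exists h, h ^+ q = g.
Proof.
pose N := [set g : G | exists h, h ^+ q = g].
have sgN : subgroup N.
  apply/subgroupP; split=> [|_ _ [x <-] [y <-]]; first by exists 1; rewrite expg1n.
  by exists (x / y); rewrite commutative_expgF.
apply: contrapT => nNg.
have [M [sgM NM nMg maxM]] := maximal_subgroup_avoiding sgN nNg.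
have [y|MG|/not_cyclic//] := not_cover sgM (cyclic_subgroup_subgroup g).
- have [|k [m [Mm ->]]] := maximal_avoiding_root pq sgM nMg maxM (y := y).
    by apply: NM; exists y.
  exists m, (g ^+ k); split=> //.
  by exists k, 0%N; rewrite expg0 invg1 mulg1.
- by apply: nMg; rewrite MG.
Qed.

Lemma exists_root_tower : exists x : nat -> G,
  [/\ x 0%N = 1, x 1%N = z & forall n, x n.+1 ^+ q = x n].
Proof.
have [r rP] := choice divisible.
exists (fun n => if n is n'.+1 then iter n' r z else 1).
by split=> // -[|n] //=.
Qed.

(** Let [M] be a maximal subgroup avoiding [z]. As the union [P] of the tower is
    divisible, an element [y] with [y ^+ q] in [P M] can be multiplied by an
    element of [P] so that its [q]-th power falls in [M]; it is then a power of
    [z] modulo [M], whence [y] is in [P M]. So [G = P M], and [M] is proper. *)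
Lemma root_tower_full (x : nat -> G) (P : set G) :
  P = [set y | exists n k, y = x n ^+ k] -> subgroup P -> x 1%N = z ->
  (forall n, x n.+1 ^+ q = x n) -> P = [set: G].
Proof.
move=> PE sgP x1 xS.
have sg1 : subgroup [set (1 : G)].
  by apply/subgroupP; split=> // _ _ -> ->; exact: mulgV.
have [M [sgM _ nMz maxM]] := maximal_subgroup_avoiding sg1 z1.
have Pz : P z by rewrite PE -x1; exists 1%N, 1%N.
have [|//|MG] := not_cover sgP sgM; last by exfalso; apply: nMz; rewrite MG.
suff PM n : forall y, M (y ^+ (q ^ n)) -> exists p m, [/\ P p, M m & y = p * m].
  by move=> y; have [n yn] := primary y; apply: (PM n); rewrite yn; exact: subgroup1.
elim: n => [|n IHn] y My.
  by exists 1, y; rewrite mul1g; split=> //; exact: subgroup1.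
have [|p [m [Pp Mm yqE]]] := IHn (y ^+ q); first by rewrite -expgnA -expnS.
have [p' Pp' pE] : exists2 p', P p' & p' ^+ q = p.
  move: Pp; rewrite PE => -[i [k ->]]; exists (x i.+1 ^+ k); first by exists i.+1, k.
  by rewrite expgnAC xS.
have [|k [m' [Mm' y'E]]] := maximal_avoiding_root pq sgM nMz maxM (y := y / p').
  by rewrite commutative_expgF yqE pE [p * m]mulC mulgK.
exists (p' * z ^+ k), m'; split=> //.
  by apply: subgroupM => //; exact: subgroupX.
by rewrite -mulgA -y'E mulC mulgVK.
Qed.

End ProperSubgroupsNotCovering.

End Abelian.

(** * Unions of towers of cyclic groups *)

Section RootTower.
Context (G : groupType) (q : nat) (pq : prime q) (x : nat -> G).
Context (x0 : x 0%N = 1%g) (x1 : x 1%N <> 1%g).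
Context (xS : forall n, (x n.+1 ^+ q)%g = x n).
Local Open Scope classical_set_scope.
Local Open Scope quotient_scope.

Let q_gt0 : (0 < q)%N := prime_gt0 pq.

Lemma root_tower_exp n m : (x (n + m) ^+ (q ^ m))%g = x n.
Proof.
elim: m => [|m IHm]; first by rewrite addn0 expn0 expg1.
by rewrite addnS expnS expgnA xS IHm.
Qed.

(** The order of [x n.+1] is [q] times that of [x n], since the power of
    [x n.+1] that lies at the bottom is [x 1], which is not trivial. *)
Lemma root_tower_order n k : ((x n ^+ k)%g = 1%g) <-> (q ^ n %| k)%N.
Proof.
split=> [|/dvdnP[j ->]]; last first.
  by rewrite mulnC expgnA -{1}[n]add0n root_tower_exp x0 expg1n.
elim: n k => [|n IHn] k xk; first exact: dvd1n.
have /dvdnP[j kE] : (q ^ n %| k)%N.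
  by apply: IHn; rewrite -xS -expgnA mulnC expgnA xk expg1n.
rewrite kE expnS dvdn_pmul2r ?expn_gt0 ?q_gt0 //.
have x1j : (x 1%N ^+ j = 1)%g.
  by rewrite -(root_tower_exp 1 n) -expgnA mulnC -kE.
apply/idPn; rewrite -prime_coprime // => qj.
apply: x1; apply: (expg_coprime_eq1 q_gt0 qj) => //.
by rewrite xS.
Qed.

Lemma root_tower_expD n m k l :
  (x n ^+ k * x m ^+ l)%g = (x (n + m) ^+ (k * q ^ m + l * q ^ n))%g.
Proof.
rewrite expgnDr [(k * _)%N]mulnC [(l * _)%N]mulnC !expgnA root_tower_exp.
by rewrite [(n + m)%N]addnC root_tower_exp.
Qed.

Lemma root_tower_subgroup : subgroup [set y : G | exists n k, y = (x n ^+ k)%g].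
Proof.
apply/subgroupP; split=> [|_ _ [n [k ->]] [m [l ->]]]; first by exists 0%N, 0%N.
have -> : ((x m ^+ l)^-1 = x m ^+ ((q ^ m).-1 * l))%g.
  apply: mulg1_eq; rewrite -expgnDr -mulSn prednK ?expn_gt0 ?q_gt0 //.
  exact/root_tower_order/dvdn_mulr.
by rewrite root_tower_expD; do 2!eexists.
Qed.

Local Open Scope ring_scope.

Definition fraction (n k : nat) : rat := k%:R / (q ^ n)%:R.

Let qn_neq0 n : (q ^ n)%:R != 0 :> rat.
Proof. by rewrite pnatr_eq0 -lt0n expn_gt0 q_gt0. Qed.

Lemma fraction_expand n m k : fraction n k = fraction (n + m) (k * q ^ m).
Proof.
by rewrite /fraction expnD !natrM -mulf_div divff // mulr1.
Qed.

Lemma fraction_intE n k : (fraction n k \in rat_int) = (q ^ n %| k)%N.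
Proof.
apply/idP/idP => [/intrP[m kE]|/Qnat_dvd]; last by rewrite natrEint => /andP[].
suff : ((q ^ n)%N %| k%:Z)%Z by [].
apply/dvdzP; exists m; apply: (@intr_inj rat).
by rewrite rmorphM /= -kE -!pmulrn divfK.
Qed.

Lemma root_tower_eq n k l :
  (x n ^+ k = x n ^+ l)%g <-> (fraction n k - fraction n l \in rat_int).
Proof.
wlog lk : k l / (l <= k)%N => [hwlog|].
  have [/hwlog//|/ltnW/hwlog lk] := leqP l k.
  by rewrite -rpredN opprB -lk; split.
rewrite /fraction -mulrBl -natrB // fraction_intE -root_tower_order expgnFr //.
by split=> [->|/divg1_eq//]; rewrite mulgV.
Qed.

(** The map sends [x n ^+ k] to the class of [k / q ^ n]; it is defined by a
    choice of [n] and [k], on which the class does not depend. *)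
Lemma root_tower_quasicyclic : (forall y, exists n k, y = (x n ^+ k)%g) ->
  exists f : G -> quasicyclic q,
    bijective f /\ {morph f : x y / (x * y)%g >-> x + y}.
Proof.
move=> xG.
have /choice[e eE] : forall y, exists e : nat * nat, y = (x e.1 ^+ e.2)%g.
  by move=> y; have [n [k ->]] := xG y; exists (n, k).
have frac_primary n k : primary_component q (\pi_QmodZ (fraction n k)).
  apply/asboolP; exists n; apply/eqP.
  rewrite -raddfMn piE Quotient.equivE subr0 -[fraction n k *+ _]mulr_natr divfK //.
  exact: rpred_nat.
pose f y : quasicyclic q := Sub (\pi_QmodZ (fraction (e y).1 (e y).2)) (frac_primary _ _).
have fE n k : val (f (x n ^+ k)%g) = \pi_QmodZ (fraction n k).
  rewrite SubK; apply/eqP; rewrite -Quotient.idealrBE.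
  set y := (x n ^+ k)%g; set m := (e y).1; set l := (e y).2.
  rewrite (fraction_expand n m) (fraction_expand m n) [(n + m)%N]addnC.
  apply/root_tower_eq; rewrite ![(_ * q ^ _)%N]mulnC !expgnA root_tower_exp -eE.
  by rewrite [(m + n)%N]addnC root_tower_exp.
have valD (u v : quasicyclic q) : val (u + v) = val u + val v by [].
exists f; split; last first.
  move=> g h; apply: val_inj; have [n [k ->]] := xG g; have [m [l ->]] := xG h.
  rewrite root_tower_expD fE valD !fE -raddfD.
  rewrite (fraction_expand n m) (fraction_expand m n) [(m + n)%N]addnC.
  by rewrite /fraction -mulrDl -natrD.
have f_inj : injective f.
  move=> g h; have [n [k ->]] := xG g; have [m [l ->]] := xG h.
  move=> /(congr1 val); rewrite !fE => /eqP; rewrite -Quotient.idealrBE.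
  rewrite (fraction_expand n m) (fraction_expand m n) [(m + n)%N]addnC.
  move=> /root_tower_eq; rewrite ![(_ * q ^ _)%N]mulnC !expgnA root_tower_exp.
  by rewrite [(n + m)%N]addnC root_tower_exp.
have f_surj u : exists g, f g = u.
  have /asboolP[n] := valP u; rewrite -[val u]reprK -raddfMn => /eqP.
  rewrite piE Quotient.equivE subr0 => /intrP[m rE].
  have qn_gt0 : (0 < (q ^ n)%N%:Z) by rewrite ltz_nat expn_gt0 q_gt0.
  (* The residue is used because the exponent has to be nonnegative. *)
  exists (x n ^+ `|(m %% (q ^ n)%N)%Z|)%g; apply: val_inj; rewrite fE -[RHS]reprK.
  apply/eqP; rewrite -Quotient.idealrBE; apply/intrP; exists (- (m %/ (q ^ n)%N)%Z).
  set r := repr _ in rE *.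
  have -> : r = m%:~R / (q ^ n)%:R by rewrite -rE -[r *+ _]mulr_natr mulfK.
  have mE : m%:~R = (m %/ (q ^ n)%N)%Z%:~R * (q ^ n)%:R + (m %% (q ^ n)%N)%Z%:~R :> rat.
    by rewrite {1}(divz_eq m (q ^ n)%N) rmorphD rmorphM.
  rewrite /fraction -mulrBl pmulrn gez0_abs ?mE; last by rewrite modz_ge0 // lt0r_neq0.
  by rewrite opprD addrCA subrr addr0 -mulNr mulfK // rmorphN.
have [g gK] := choice f_surj; exists g => // y; exact: f_inj.
Qed.

End RootTower.

(** * The structure of the group *)

Theorem theorem2p3 (G : groupType) (R : pzRingType)
    (A : lmodType (group_ring R G)^c)
    (G_infinite : infinite_set [set: G]%classic)
    (G_not_perfect : derived_subgroup G <> [set: G]%classic)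
    (faithful : cent_grp A = [set 1%g]%classic)
    (quotG_infinite :
      infinite_set [set: quot_cent A [set: G]%classic]%classic)
    (quotH_finite : forall H : set G, subgroup H -> H <> [set: G]%classic ->
      finite_set [set: quot_cent A H]%classic) :
  exists q : nat, prime q /\
    exists f : G -> quasicyclic q,
      bijective f /\ {morph f : x y / (x * y)%g >-> (x + y)%R}.
Proof.
have mulC := mulg_commute G_infinite quotG_infinite quotH_finite
  G_not_perfect faithful.
have tor := torsion G_infinite quotG_infinite quotH_finite
  G_not_perfect faithful.
have not_cover := proper_subgroups_not_cover quotG_infinite quotH_finite.
have not_cyclic := cyclic_subgroup_proper G_infinite quotG_infinite quotH_finite.
have [x x1] : exists x : G, x <> 1%g.
  apply: contrapT => all1; apply: (not_cyclic 1%g); apply/seteqP; split=> // x _.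
  have -> : x = 1%g by apply: contrapT => x1; apply: all1; exists x.
  exact: cyclic_subgroup_id.
have [e e_gt0 xe] := tor x.
have [q [z [pq z1 zq]]] := exists_order_prime e_gt0 xe x1.
have [t [t0 t1 tS]] := exists_root_tower mulC not_cover not_cyclic pq zq.
exists q; split=> //; move: z1; rewrite -t1 => z1.
apply: (root_tower_quasicyclic pq t0 z1 tS) => y.
have sgP := root_tower_subgroup pq t0 z1 tS.
by rewrite t1 in z1; have /seteqP[_ /(_ y)] :=
  root_tower_full mulC tor not_cover pq z1 zq erefl sgP t1 tS; apply.
Qed.
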